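(* Let $G$ be a simple graph with no induced $3$-cycles and no induced $4$-cycles, and let $I(G)\subseteq R=\Bbbk[G]$ be its edge ideal. Then $T^2(R/I(G))=0$.
   Context: Conventions. $\Bbbk$ is a field. Graphs are finite without isolated vertices; simple means no loops and no multiple edges. $R=\Bbbk[G]$ is the polynomial ring whose indeterminates are the vertices of $G$; the edge ideal $I=I(G)$ is generated by the monomials $ab$ with $\{a,b\}\in E(G)$. Second cotangent cohomology. Let $A=R/I$, let $m=|E(G)|$, let $R^m$ be free with basis $\epsilon_e$ ($e\in E(G)$), let $j:R^m\to R$ send $\epsilon_e$ to the monomial $e$, let $K=\ker j$, and let $K_0\subseteq K$ be the submodule generated by the Koszul relations $j(\epsilon_e)\epsilon_{e'}-j(\epsilon_{e'})\epsilon_e$, $e\neq e'$. $K/K_0$ is an $A$-module, and restricting homomorphisms to $K$ gives a map $\Phi:\operatorname{Hom}_R(R^m,A)\to\operatorname{Hom}_A(K/K_0,A)$; $T^2(A)=\operatorname{coker}\Phi$. *)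

(* Defs.v *)
From HB Require Import structures.
From mathcomp Require Import all_boot all_algebra.
From mathcomp Require Import boolp.
From mathcomp Require Import mpoly.

Set Implicit Arguments.
Unset Strict Implicit.
Unset Printing Implicit Defensive.

Import GRing.Theory.
Local Open Scope ring_scope.
Local Open Scope quotient_scope.

Section QuotientModule.
Variables (A : pzRingType) (M : lmodType A) (S : submodClosed M).

(* [submodClosed] does not inherit from [zmodClosed], on which the quotients
   are built. *)
Definition submod_pred : {pred M} := fun x => x \in S.

Fact submod_pred_closed : zmod_closed submod_pred.
Proof. by have /GRing.submod_closedB := submodClosedP S. Qed.
HB.instance Definition _ :=
  GRing.isZmodClosed.Build M submod_pred submod_pred_closed.

Definition quot_mod : Type := {ideal_quot submod_pred}.

HB.instance Definition _ := GRing.Zmodule.on quot_mod.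

Definition to_quot_mod (x : M) : quot_mod := \pi_{ideal_quot submod_pred} x.
Definition of_quot_mod (q : quot_mod) : M := repr (q : {ideal_quot submod_pred}).

Lemma of_quot_modK : cancel of_quot_mod to_quot_mod.
Proof. by move=> q; rewrite /to_quot_mod /of_quot_mod reprK. Qed.

Lemma to_quot_modP (x y : M) :
  reflect (to_quot_mod x = to_quot_mod y) (x - y \in S).
Proof. by rewrite -[_ \in S]/(_ \in submod_pred) Quotient.idealrBE; apply: eqP. Qed.

Lemma to_quot_modB x y :
  to_quot_mod (x - y) = to_quot_mod x - to_quot_mod y.
Proof. exact: raddfB. Qed.

Lemma to_quot_modD x y :
  to_quot_mod (x + y) = to_quot_mod x + to_quot_mod y.
Proof. exact: raddfD. Qed.

Definition quot_scale (a : A) (q : quot_mod) : quot_mod :=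
  to_quot_mod (a *: of_quot_mod q).

Lemma to_quot_modZ a x : to_quot_mod (a *: x) = quot_scale a (to_quot_mod x).
Proof.
apply/to_quot_modP; rewrite -scalerBr rpredZ //.
by apply/to_quot_modP; rewrite of_quot_modK.
Qed.

Fact quot_scaleA a b q : quot_scale a (quot_scale b q) = quot_scale (a * b) q.
Proof. by rewrite -[q]of_quot_modK -!to_quot_modZ scalerA. Qed.

Fact quot_scale1 : left_id 1 quot_scale.
Proof. by move=> q; rewrite -[q]of_quot_modK -!to_quot_modZ scale1r. Qed.

Fact quot_scaleDr : right_distributive quot_scale +%R.
Proof.
move=> a p q; rewrite -[p]of_quot_modK -[q]of_quot_modK.
by rewrite -to_quot_modD -!to_quot_modZ -to_quot_modD scalerDr.
Qed.

Fact quot_scaleDl q : {morph quot_scale^~ q : a b / a + b}.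
Proof.
move=> a b; rewrite /= -[q]of_quot_modK.
by rewrite -!to_quot_modZ -to_quot_modD scalerDl.
Qed.

HB.instance Definition _ := GRing.Zmodule_isLmodule.Build A quot_mod
  quot_scaleA quot_scale1 quot_scaleDr quot_scaleDl.

End QuotientModule.

Section HomModule.
Variables (A : comNzRingType) (U V : lmodType A).

Definition Hom : Type := {linear U -> V}.

Definition hom_fun (f : Hom) : {linear U -> V} := f.
Coercion hom_fun : Hom >-> GRing.Linear.type.

HB.instance Definition _ := gen_eqMixin Hom.
HB.instance Definition _ := gen_choiceMixin Hom.

Lemma homP (f g : Hom) : f =1 g -> f = g.
Proof.
case: f g => [f [[fa] [fb]]] [g [[ga] [gb]]] /= fg.
have {}fg : f = g by apply: funext.
case: g / fg ga gb => ga gb.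
by congr GRing.Linear.Pack; congr GRing.Linear.Class;
  congr (_ _); apply: Prop_irrelevance.
Qed.

Definition hom_zero : Hom := (\0 : {linear U -> V}).
Definition hom_opp (f : Hom) : Hom := (\- f : {linear U -> V}).
Definition hom_add (f g : Hom) : Hom := (f \+ g : {linear U -> V}).
Definition hom_scale (a : A) (f : Hom) : Hom := (a \*: f : {linear U -> V}).

Fact hom_addA : associative hom_add.
Proof. by move=> f g h; apply: homP => x /=; rewrite addrA. Qed.
Fact hom_addC : commutative hom_add.
Proof. by move=> f g; apply: homP => x /=; rewrite addrC. Qed.
Fact hom_add0 : left_id hom_zero hom_add.
Proof. by move=> f; apply: homP => x /=; rewrite add0r. Qed.
Fact hom_addN : left_inverse hom_zero hom_opp hom_add.
Proof. by move=> f; apply: homP => x /=; rewrite addNr. Qed.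

HB.instance Definition _ :=
  GRing.isZmodule.Build Hom hom_addA hom_addC hom_add0 hom_addN.

Fact hom_scaleA a b f : hom_scale a (hom_scale b f) = hom_scale (a * b) f.
Proof. by apply: homP => x /=; rewrite scalerA. Qed.
Fact hom_scale1 : left_id 1 hom_scale.
Proof. by move=> f; apply: homP => x /=; rewrite scale1r. Qed.
Fact hom_scaleDr : right_distributive hom_scale +%R.
Proof. by move=> a f g; apply: homP => x /=; rewrite scalerDr. Qed.
Fact hom_scaleDl f : {morph hom_scale^~ f : a b / a + b}.
Proof. by move=> a b; apply: homP => x /=; rewrite scalerDl. Qed.

HB.instance Definition _ := GRing.Zmodule_isLmodule.Build A Hom
  hom_scaleA hom_scale1 hom_scaleDr hom_scaleDl.

End HomModule.

(* A finite family of generators of a proper ideal. *)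
Record proper_family (R : comNzRingType) (E : finType) := ProperFamily {
  gen :> E -> R;
  gen_proper : forall c : E -> R, 1 <> \sum_e c e * gen e
}.

Section CotangentCohomology.
Variables (R : comNzRingType) (E : finType) (m : proper_family R E).

Definition gen_ideal : {pred R} :=
  fun p => `[< exists c : E -> R, p = \sum_e c e * m e >].

Fact gen_ideal_closed : idealr_closed gen_ideal.
Proof.
split.
- apply/asboolP; exists (fun=> 0).
  by rewrite big1 // => e _; rewrite mul0r.
- by apply/asboolP => -[c]; apply: gen_proper.
- move=> a u v /asboolP[c ->] /asboolP[d ->].
  apply/asboolP; exists (fun e => a * c e + d e).
  rewrite mulr_sumr -big_split /=; apply: eq_bigr => e _.
  by rewrite mulrA mulrDl.
Qed.
HB.instance Definition _ := isIdealr.Build R gen_ideal gen_ideal_closed.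

Definition quot_ring : Type := {ideal_quot gen_ideal}.
HB.instance Definition _ := GRing.ComNzRing.on quot_ring.

Local Notation A := quot_ring.

Definition to_quot (p : R) : A := \pi_{ideal_quot gen_ideal} p.
HB.instance Definition _ :=
  GRing.RMorphism.copy to_quot (\pi_{ideal_quot gen_ideal}).

(* R^o is R as a module over itself. *)
Definition Rm : Type := {ffun E -> R^o}.
HB.instance Definition _ := GRing.Lmodule.on Rm.

Definition eps (e : E) : Rm := [ffun e' => (e' == e)%:R].

Definition jmap (f : Rm) : R := \sum_e f e * m e.

Fact jmap_is_linear : linear_for *%R jmap.
Proof.
move=> a f g; rewrite /jmap mulr_sumr -big_split; apply: eq_bigr => e _.
by rewrite /= !ffunE mulrDl mulrA.
Qed.
HB.instance Definition _ :=
  GRing.isLinear.Build R Rm R *%R jmap jmap_is_linear.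

Lemma jmap_eps e : jmap (eps e) = m e.
Proof.
rewrite /jmap (bigD1 e) //= ffunE eqxx mul1r big1 ?addr0 // => e' /negPf ne.
by rewrite ffunE ne mul0r.
Qed.

Definition in_ker : {pred Rm} := fun f => jmap f == 0.

Fact in_ker_closed : submod_closed in_ker.
Proof.
split; first by rewrite unfold_in raddf0.
move=> a f g; rewrite !unfold_in => /eqP jf /eqP jg.
by rewrite jmap_is_linear jf jg mulr0 addr0.
Qed.
HB.instance Definition _ := GRing.isSubmodClosed.Build R Rm in_ker in_ker_closed.

(* The submodule K = ker j of R^m, as an R-module in its own right. *)
Record ker : Type := Ker { ker_val : Rm; ker_valP : ker_val \in in_ker }.
HB.instance Definition _ := [isSub for ker_val].
HB.instance Definition _ := [Choice of ker by <:].
HB.instance Definition _ := [SubChoice_isSubLmodule of ker by <:].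

Local Notation K := ker.

Definition koszul (e e' : E) : Rm :=
  jmap (eps e) *: eps e' - jmap (eps e') *: eps e.

Lemma koszulE e e' :
  koszul e e' = m e *: eps e' - m e' *: eps e.
Proof. by rewrite /koszul !jmap_eps. Qed.

Lemma koszul_in_ker e e' : koszul e e' \in in_ker.
Proof.
have jZ p f : jmap (p *: f) = p * jmap f by exact: linearZ_LR.
by rewrite unfold_in koszulE raddfB /= !jZ !jmap_eps mulrC subrr.
Qed.

Definition koszul_sub : {pred K} := fun z =>
  `[< exists c : E -> E -> R,
        val z = \sum_e \sum_(e' | e != e') c e e' *: koszul e e' >].

Fact koszul_sub_closed : submod_closed koszul_sub.
Proof.
split.
  apply/asboolP; exists (fun _ _ => 0); rewrite raddf0.
  by rewrite big1 // => e _; rewrite big1 // => e' _; rewrite scale0r.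
move=> a u v /asboolP[c cu] /asboolP[d dv]; apply/asboolP.
exists (fun e e' => a * c e e' + d e e').
rewrite linearP /= cu dv scaler_sumr -big_split /=; apply: eq_bigr => e _.
rewrite scaler_sumr -big_split /=; apply: eq_bigr => e' _.
by rewrite scalerDl scalerA.
Qed.
HB.instance Definition _ :=
  GRing.isSubmodClosed.Build R K koszul_sub koszul_sub_closed.

Definition koszul_quot : Type := quot_mod koszul_sub.
HB.instance Definition _ := GRing.Zmodule.on koszul_quot.

Definition koszul_class (z : K) : koszul_quot := to_quot_mod koszul_sub z.
Definition koszul_repr (q : koszul_quot) : K := of_quot_mod q.

Lemma koszul_reprK : cancel koszul_repr koszul_class.
Proof. exact: of_quot_modK. Qed.

Lemma koszul_classP (z w : K) :
  reflect (koszul_class z = koszul_class w) (z - w \in koszul_sub).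
Proof. exact: to_quot_modP. Qed.

Lemma koszul_classD z w :
  koszul_class (z + w) = koszul_class z + koszul_class w.
Proof. exact: to_quot_modD. Qed.

Lemma koszul_classB z w :
  koszul_class (z - w) = koszul_class z - koszul_class w.
Proof. exact: to_quot_modB. Qed.

Lemma eps_scaleE (p : R) e e' : (p *: eps e) e' = p * (e' == e)%:R.
Proof. by rewrite ffunE /eps ffunE. Qed.

Lemma Rm_decomp (f : Rm) : f = \sum_e f e *: eps e.
Proof.
apply/ffunP => e; rewrite sum_ffunE.
under eq_bigr => e' _ do rewrite eps_scaleE.
rewrite (bigD1 e) //= eqxx mulr1.
rewrite big1 ?addr0 // => e' /negPf ne.
by rewrite eq_sym ne mulr0.
Qed.

Lemma gen_ideal_scale (p : R) (z : K) :
  p \in gen_ideal -> p *: z \in koszul_sub.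
Proof.
case/asboolP => c ->; apply/asboolP; exists (fun e e' => c e * val z e').
rewrite linearZ /= scaler_suml; apply: eq_bigr => e _.
have /eqP jz : jmap (val z) == 0 := ker_valP z.
have {1}-> : val z = \sum_e' val z e' *: eps e' by exact: Rm_decomp.
have /esym/eqP : jmap (val z) *: eps e = 0 by rewrite jz scale0r.
rewrite /jmap scaler_suml => /eqP jz0.
transitivity (c e *: \sum_e' val z e' *: koszul e e').
  rewrite -scalerA; congr (_ *: _).
  rewrite -[LHS]subr0 [X in _ - X]jz0 scaler_sumr -sumrB; apply: eq_bigr => e' _.
  by rewrite koszulE scalerBr !scalerA [m e * _]mulrC.
rewrite scaler_sumr (bigD1 e) //= [koszul e e]subrr !scaler0 add0r.
by apply: eq_big => [e'|e' _]; rewrite 1?eq_sym // scalerA.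
Qed.

(* The action of A descends from that of R because I * K is contained in K_0. *)
Definition koszul_scale (a : A) (q : koszul_quot) : koszul_quot :=
  koszul_class (repr a *: koszul_repr q).

Lemma to_quotP (p q : R) :
  reflect (to_quot p = to_quot q) (p - q \in gen_ideal).
Proof. by rewrite Quotient.idealrBE; apply: eqP. Qed.

Lemma repr_quotK (a : A) : to_quot (repr a) = a.
Proof. exact: reprK. Qed.

Lemma koszul_classZ p z :
  koszul_class (p *: z) = koszul_scale (to_quot p) (koszul_class z).
Proof.
apply/koszul_classP.
set z' := koszul_repr _; set p' := repr _.
have -> : p *: z - p' *: z' = (p - p') *: z + p' *: (z - z').
  by rewrite scalerBl scalerBr addrA subrK.
apply: rpredD.
  by apply/gen_ideal_scale/to_quotP; rewrite repr_quotK.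
by apply: rpredZ; apply/koszul_classP; rewrite koszul_reprK.
Qed.

Fact koszul_scaleA a b q :
  koszul_scale a (koszul_scale b q) = koszul_scale (a * b) q.
Proof.
rewrite -[a]repr_quotK -[b]repr_quotK -[q]koszul_reprK.
by rewrite -rmorphM -!koszul_classZ scalerA.
Qed.

Fact koszul_scale1 : left_id 1 koszul_scale.
Proof.
move=> q; rewrite -[q]koszul_reprK -[1](rmorph1 to_quot).
by rewrite -koszul_classZ scale1r.
Qed.

Fact koszul_scaleDr : right_distributive koszul_scale +%R.
Proof.
move=> a p q; rewrite -[a]repr_quotK -[p]koszul_reprK -[q]koszul_reprK.
by rewrite -koszul_classD -!koszul_classZ -koszul_classD scalerDr.
Qed.

Fact koszul_scaleDl q : {morph koszul_scale^~ q : a b / a + b}.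
Proof.
move=> a b; rewrite -[a]repr_quotK -[b]repr_quotK.
rewrite -[q]koszul_reprK /= -rmorphD.
by rewrite -!koszul_classZ -koszul_classD scalerDl.
Qed.

HB.instance Definition _ := GRing.Zmodule_isLmodule.Build A koszul_quot
  koszul_scaleA koszul_scale1 koszul_scaleDr koszul_scaleDl.

(* Hom_R(R^m, A): R acts on A through the projection R -> A. *)
Definition HomRm : Type := {linear Rm -> A | to_quot \; *%R}.

Definition HomK : Type := Hom koszul_quot (A^o).
HB.instance Definition _ := GRing.Lmodule.on HomK.

Section Restriction.
Variable phi : HomRm.

(* Well defined on classes because phi vanishes on K_0; see [PhiE]. *)
Definition restrict_fun (q : koszul_quot) : A^o := phi (val (koszul_repr q)).

Lemma phi_koszul (z : K) : z \in koszul_sub -> phi (val z) = 0.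
Proof.
case/asboolP => c ->; rewrite raddf_sum big1 // => e _.
rewrite raddf_sum big1 // => e' _.
have phiZ p f : phi (p *: f) = to_quot p * phi f by exact: linearZ_LR.
have phiB f g : phi (f - g) = phi f - phi g by exact: raddfB.
transitivity (to_quot (c e e') * phi (koszul e e')); first exact: phiZ.
rewrite koszulE phiB !phiZ.
have I0 e0 : to_quot (m e0) = 0.
  rewrite -(rmorph0 to_quot); apply/to_quotP/asboolP.
  exists (fun e1 => (e1 == e0)%:R); rewrite subr0 (bigD1 e0) //= eqxx mul1r.
  by rewrite big1 ?addr0 // => e1 /negPf ->; rewrite mul0r.
by rewrite !I0 !mul0r subr0 mulr0.
Qed.

Lemma restrict_class (z : K) : restrict_fun (koszul_class z) = phi (val z).
Proof.
apply/eqP; rewrite -subr_eq0 -raddfB -raddfB; apply/eqP/phi_koszul.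
by apply/koszul_classP; rewrite koszul_reprK.
Qed.

Fact restrict_is_linear : linear restrict_fun.
Proof.
move=> a q r; rewrite -[a]repr_quotK -[q]koszul_reprK -[r]koszul_reprK.
rewrite -[_ *: koszul_class _]koszul_classZ -koszul_classD !restrict_class.
have valP3 p (z w : K) : val (p *: z + w) = p *: val z + val w.
  exact: linearP.
by rewrite valP3; exact: linearP.
Qed.
HB.instance Definition _ := GRing.isLinear.Build A koszul_quot (A^o) *:%R
  restrict_fun restrict_is_linear.

Definition Phi : HomK := (restrict_fun : {linear koszul_quot -> A^o}).

Lemma PhiE (z : K) : Phi (koszul_class z) = phi (val z).
Proof. exact: restrict_class. Qed.

End Restriction.

Definition im_Phi : {pred HomK} := fun h => `[< exists phi, h = Phi phi >].

Fact im_Phi_closed : submod_closed im_Phi.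
Proof.
split.
  by apply/asboolP; exists (\0 : HomRm); apply: homP => q.
move=> a h1 h2 /asboolP[phi1 ->] /asboolP[phi2 ->]; apply/asboolP.
pose phi (f : Rm) : A := a * phi1 f + phi2 f.
have phi_lin : linear_for (to_quot \; *%R) phi.
  move=> p f g; rewrite /phi !linearP /=.
  by rewrite !mulrDr mulrCA addrACA.
pose phiM := GRing.isLinear.Build R Rm A (to_quot \; *%R) phi phi_lin.
pose phiL : HomRm := HB.pack phi phiM.
by exists phiL; apply: homP => q.
Qed.
HB.instance Definition _ :=
  GRing.isSubmodClosed.Build A HomK im_Phi im_Phi_closed.

Definition T2 : Type := quot_mod im_Phi.
HB.instance Definition _ := GRing.Lmodule.on T2.

End CotangentCohomology.

Record sgraph := SGraph {
  vertex :> finType;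
  adj : rel vertex;
  adj_sym : ssrbool.symmetric adj;
  adj_irrefl : irreflexive adj
}.

Definition no_isolated (G : sgraph) := forall x : G, exists y : G, adj x y.

(* The usual notion for n >= 3; [ordS i] is i + 1 modulo n. *)
Definition induced_cycle (G : sgraph) (n : nat) (c : 'I_n -> G) :=
  injective c /\
  forall i j, adj (c i) (c j) = (j == ordS i) || (i == ordS j).

Definition has_induced_cycle (G : sgraph) (n : nat) :=
  exists c : 'I_n -> G, induced_cycle c.

Definition edges (G : sgraph) : {set {set G}} :=
  [set [set p.1; p.2] | p in [pred p : G * G | adj p.1 p.2]].

Definition edge (G : sgraph) : finType := {e : {set G} | e \in edges G}.

Section EdgeIdeal.
Variables (k : fieldType) (G : sgraph).

Local Notation R := {mpoly k[#|G|]}.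

Definition var (x : G) : R := 'X_(enum_rank x).

Definition edge_mon (e : edge G) : R := \prod_(x in val e) var x.

Lemma edge_mon_at0 (e : edge G) : (edge_mon e).@[fun=> 0] = 0.
Proof.
case: e => e /= /[dup] /imsetP[[x y] _ ->] h.
rewrite /edge_mon /= (bigD1 x) ?set21 //=.
by rewrite mevalM mevalXU mul0r.
Qed.

Fact edge_mon_proper (c : edge G -> R) : 1 <> \sum_e c e * edge_mon e.
Proof.
move=> /(congr1 (meval (fun=> 0))).
rewrite meval1 raddf_sum big1 => [/eqP|e _]; first by rewrite oner_eq0.
by rewrite /= mevalM edge_mon_at0 mulr0.
Qed.

(* I(G) is [gen_ideal edge_family], and R / I(G) is [quot_ring edge_family]. *)
Definition edge_family : proper_family R (edge G) :=
  ProperFamily edge_mon_proper.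

End EdgeIdeal.

(* Main.v *)
From HB Require Import structures.
Require Import Defs.
From mathcomp Require Import all_boot all_algebra.
From mathcomp Require Import boolp mpoly.

(* The module K is generated by the Koszul relations and by the relations
   r(b; a, c) = c eps_ab - a eps_bc, one for each path a - b - c.  So a
   homomorphism h on K / K_0 comes from R^m as soon as there are g_ab in A with
   c g_ab - a g_bc = h (r(b; a, c)) for all paths.  Comparing coefficients at
   standard monomials (those outside I), this becomes a problem on scalars,
   where h is only used through three relations:
     - b h (r(b; a, c)) = 0;
     - d h (r(b; a, c)) + a h (r(b; c, d)) + c h (r(b; d, a)) = 0 for three
       neighbours a, c, d of b;
     - d h (r(b; a, c)) + a h (r(c; b, d)) = 0 for a path a - b - c - d.
   The coefficient of g_ab at M is read off from h (r(b; a, z)) at M z, where z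
   is any neighbour of b, or symmetrically from h (r(a; b, z)), such that M z is
   standard.  That the choice of z is irrelevant follows by cancelling a variable
   in one of the last two relations, provided the monomial reached is standard;
   this holds because two neighbours of b are not adjacent, and the ends of a
   path a - b - c - d are not adjacent. *)

Set Implicit Arguments.
Unset Strict Implicit.
Unset Printing Implicit Defensive.

Import GRing.Theory.
Local Open Scope ring_scope.

Lemma set2_eqP (T : finType) (x y z t : T) : [set x; y] = [set z; t] ->
  (x = z /\ y = t) \/ (x = t /\ y = z).
Proof.
move=> e; have hx : x \in [set z; t] by rewrite -e set21.
have hy : y \in [set z; t] by rewrite -e set22.
have hz : z \in [set x; y] by rewrite e set21.
have ht : t \in [set x; y] by rewrite e set22.
case/set2P: hx hy hz ht => -> /set2P[] -> /set2P[] ? /set2P[] ?; subst; auto.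
Qed.

(** * Triangles and squares in the graph *)

Section Girth.
Variable G : sgraph.

Lemma adj_neq (x y : G) : adj x y -> x != y.
Proof. by apply: contraTneq => ->; rewrite adj_irrefl. Qed.

(** Three pairwise adjacent vertices are distinct and leave no room for a chord, so they form an
    induced 3-cycle. *)
Lemma no_triangle (x y z : G) :
  ~ has_induced_cycle G 3 -> adj x y -> adj x z -> ~~ adj y z.
Proof.
move=> noC3 xy xz; apply/negP => yz; apply: noC3.
exists (fun i => nth x [:: x; y; z] i); split.
  have s_uniq : uniq [:: x; y; z] by rewrite /= !inE negb_or !adj_neq.
  by move=> i j /eqP; rewrite nth_uniq // => /eqP /val_inj.
by move=> [[|[|[|?]]] ?] [[|[|[|?]]] ?] //=;
  rewrite ?adj_irrefl ?xy ?yz ?xz // adj_sym ?xy ?yz ?xz.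
Qed.

(** A chord of the closed walk x, y, z, t would create a triangle; hence, if [x] and [t] were
    adjacent, the 4-cycle would be induced. *)
Lemma no_square (x y z t : G) :
    ~ has_induced_cycle G 3 -> ~ has_induced_cycle G 4 ->
    x != z -> y != t ->
  adj x y -> adj y z -> adj z t -> ~~ adj x t.
Proof.
move=> noC3 noC4 xz yt xy yz zt; apply/negP => xt; apply: noC4.
have /negPf nxz : ~~ adj x z by apply: (no_triangle noC3 _ yz); rewrite adj_sym.
have /negPf nyt : ~~ adj y t by apply: (no_triangle noC3 _ zt); rewrite adj_sym.
exists (fun i => nth x [:: x; y; z; t] i); split.
  have s_uniq : uniq [:: x; y; z; t] by rewrite /= !inE !negb_or xz yt !adj_neq.
  by move=> i j /eqP; rewrite nth_uniq // => /eqP /val_inj.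
by move=> [[|[|[|[|?]]]] ?] [[|[|[|[|?]]]] ?] //=;
  rewrite ?adj_irrefl ?xy ?yz ?zt ?xt ?nxz ?nyt // adj_sym
          ?xy ?yz ?zt ?xt ?nxz ?nyt.
Qed.

End Girth.

(** * Monomials outside the edge ideal *)

Section StandardMonomials.
Variable G : sgraph.
Local Notation mon := 'X_{1..#|G|}.

Definition mult (m : mon) (x : G) : nat := m (enum_rank x).
Definition mvar (x : G) : mon := U_(enum_rank x)%MM.

Lemma mnm_mult (m : mon) x : m (enum_rank x) = mult m x. Proof. by []. Qed.

Lemma multD (m1 m2 : mon) x : mult (m1 + m2)%MM x = (mult m1 x + mult m2 x)%N.
Proof. by rewrite /mult mnmDE. Qed.

Lemma multB (m1 m2 : mon) x : mult (m1 - m2)%MM x = (mult m1 x - mult m2 x)%N.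
Proof. by rewrite /mult mnmBE. Qed.

Lemma mult_mvar x y : mult (mvar x) y = (x == y).
Proof. by rewrite /mult mnm1E (inj_eq enum_rank_inj). Qed.

Definition mult_simp := (multD, multB, mult_mvar).

Lemma multP (m1 m2 : mon) : mult m1 =1 mult m2 -> m1 = m2.
Proof.
move=> eqm; apply/mnmP => i; rewrite -[i]enum_valK; exact: eqm.
Qed.

Lemma addmAC (m1 m2 m3 : mon) : (m1 + m2 + m3 = m1 + m3 + m2)%MM.
Proof. by rewrite -!addmA [(m2 + m3)%MM]addmC. Qed.

(** The support of [m] is an independent set of [G]. The classes of these monomials form a basis of
    R / I(G); see [mem_edge_idealP]. *)
Definition standard (m : mon) : bool :=
  [forall x : G, forall y, adj x y ==> (mult m x == 0) || (mult m y == 0)].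

Lemma standardP (m : mon) :
  reflect (forall x y : G, adj x y -> (0 < mult m x -> 0 < mult m y -> False)%N)
          (standard m).
Proof.
apply: (iffP forallP) => [std x y xy|std x].
  move: (forallP (std x) y); rewrite xy /= => /orP[] /eqP -> //.
apply/forallP => y; apply/implyP => xy; rewrite -!leqn0 ![(_ <= 0)%N]leqNgt.
by rewrite -negb_and; apply/negP => /andP[]; apply: std xy.
Qed.

Lemma standard_sub (m1 m2 : mon) :
  (forall x, 0 < mult m1 x -> 0 < mult m2 x)%N -> standard m2 -> standard m1.
Proof.
move=> sub /standardP std; apply/standardP => x y xy m1x m1y.
by apply: (std x y xy); apply: sub.
Qed.

Lemma standardB (m m' : mon) : standard m -> standard (m - m')%MM.
Proof.
apply: standard_sub => x; rewrite multB => h.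
exact: leq_trans h (leq_subr _ _).
Qed.

(** An edge inside the support of m x y that is not {x, y} already lies in the support of m x or of
    m y. *)
Lemma standardD (m : mon) x y : ~~ adj x y ->
  standard (m + mvar x)%MM -> standard (m + mvar y)%MM ->
  standard (m + mvar x + mvar y)%MM.
Proof.
move=> nxy; have nyx : ~~ adj y x by rewrite adj_sym.
move=> /standardP sx /standardP sy; apply/standardP => s t st.
move: (sx s t st) (sy s t st); rewrite !mult_simp.
case: (mult m s) => [|i]; case: (mult m t) => [|j] //; rewrite ?add0n.
- case: (x =P s) => [xs|_]; case: (x =P t) => [xt|_];
  case: (y =P s) => [ys|_]; case: (y =P t) => [yt|_] //=; move: st;
  by rewrite -?xs -?ys -?xt -?yt ?adj_irrefl ?(negPf nxy) ?(negPf nyx).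
- by case: (x == s); case: (y == s); rewrite //=; auto.
- by case: (x == t); case: (y == t); rewrite //=; auto.
Qed.

End StandardMonomials.

(** * The problem on scalars and its solution *)

Section Potential.
Variables (G : sgraph) (V : zmodType).
Local Notation mon := 'X_{1..#|G|}.
Hypothesis noC3 : ~ has_induced_cycle G 3.
Hypothesis noC4 : ~ has_induced_cycle G 4.

(** Multiplication by the variable [x], seen on families of coefficients; see [coefXM]. *)
Definition shift (x : G) (f : mon -> V) (m : mon) : V :=
  if mult m x == 0%N then 0 else f (m - mvar x)%MM.

Lemma shift0 x f m : mult m x = 0%N -> shift x f m = 0.
Proof. by rewrite /shift => ->. Qed.

Lemma shiftD x f m m' : m = (m' + mvar x)%MM -> shift x f m = f m'.
Proof. by move=> ->; rewrite /shift !mult_simp eqxx addn1 addmK. Qed.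

(* [lam b a c m] stands for the coefficient at [m] of the value of a
   homomorphism on the relation [c ab - a bc]. *)
Variable lam : G -> G -> G -> mon -> V.
Hypothesis lam_anti : forall b a c m, adj b a -> adj b c -> standard m ->
  lam b a c m = - lam b c a m.
Hypothesis lam_mul : forall b a c m, adj b a -> adj b c ->
  standard (m + mvar b)%MM -> lam b a c m = 0.
Hypothesis lam_star : forall b a c d m, adj b a -> adj b c -> adj b d ->
  standard m ->
  shift d (lam b a c) m + shift a (lam b c d) m + shift c (lam b d a) m = 0.
Hypothesis lam_path : forall a b c d m, adj a b -> adj b c -> adj c d ->
  standard m -> shift d (lam b a c) m + shift a (lam c b d) m = 0.

Definition base_nbr (y : G) (m : mon) : option G :=
  [pick z | adj y z && standard (m + mvar z)%MM].

(* When the monomial [m] involves one end [x] of [e], the auxiliary neighbour [z]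
   has to depend only on [y] and [m / x], so that it is shared by all edges at
   [y]; when [m] involves neither end, any choice will do. *)
Definition pot (e : {set G}) (m : mon) : V :=
  if [pick p : G * G | [&& e == [set p.1; p.2], 0 < mult m p.1
                         & mult m p.2 == 0]%N] is Some (x, y)
  then if base_nbr y (m - mvar x)%MM is Some z
       then lam y x z (m + mvar z)%MM else 0
  else if [pick t : G * G * G | [&& e == [set t.1.1; t.1.2], adj t.1.2 t.2,
                      t.2 != t.1.1 & standard (m + mvar t.2)%MM]]
          is Some (x, y, z) then lam y x z (m + mvar z)%MM else 0.

(** The neighbour [z] picked by [pot] may hang on either end of the edge. If it hangs on [b],
    compare it with [c] by [lam_star] at m c z, where the term shifted by [a] vanishes. If it hangs
    on [a], use [lam_path] along c - b - a - z. *)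
Lemma pot_neither (a b c : G) (m : mon) : adj a b -> adj b c -> c != a ->
    mult m a = 0%N -> mult m b = 0%N -> standard (m + mvar c)%MM ->
  pot [set a; b] m = lam b a c (m + mvar c)%MM.
Proof.
move=> ab bc ca ma mb std_c.
rewrite /pot; case: pickP => [[x y] /= /and3P[/eqP/set2_eqP xy mx _]|_].
  by case: xy mx => -[<- <-]; rewrite ?ma ?mb.
case: pickP => [[[x y] z] /= /and4P[/eqP/set2_eqP xy yz zx std_z]|/(_ (a, b, c))];
  last by rewrite /= eqxx bc ca std_c.
have ba : adj b a by rewrite adj_sym.
have cb : adj c b by rewrite adj_sym.
case: xy yz zx => -[? ?] yz zx; subst x y.
  have std : standard (m + mvar c + mvar z)%MM.
    by apply: standardD std_c std_z; apply: no_triangle bc yz.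
  have := lam_star ba bc yz std.
  have -> : shift a (lam b c z) (m + mvar c + mvar z)%MM = 0.
    by rewrite shift0 // !mult_simp ma (negPf ca) (negPf zx).
  rewrite (shiftD _ erefl) (@shiftD c _ _ (m + mvar z)%MM) 1?[in RHS]addmAC //.
  by rewrite addr0 [lam b z a _]lam_anti // => /eqP; rewrite subr_eq0 => /eqP.
(* This is where induced 4-cycles must be excluded: the ends of the path c - b - a - z are not
   adjacent. *)
have std : standard (m + mvar c + mvar z)%MM.
  apply: standardD std_c std_z.
  by apply: (no_square noC3 noC4 ca _ cb ba yz); rewrite eq_sym.
have := lam_path cb ba yz std.
rewrite (shiftD _ erefl) (@shiftD c _ _ (m + mvar z)%MM) 1?[in RHS]addmAC //.
by rewrite [lam b c a _]lam_anti // => /eqP; rewrite addrC subr_eq0 => /eqP.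
Qed.

(** Only the orientation (a, b) of the edge passes the first test in [pot]. *)
Lemma pot_one (a b z : G) (m : mon) : (0 < mult m a)%N -> mult m b = 0%N ->
  base_nbr b (m - mvar a)%MM = Some z ->
  pot [set a; b] m = lam b a z (m + mvar z)%MM.
Proof.
move=> ma mb zP; rewrite /pot; case: pickP => [[x y]|/(_ (a, b))] /=; last first.
  by rewrite eqxx ma mb.
case/and3P => /eqP/set2_eqP[][<- <-]; first by rewrite zP.
by rewrite mb.
Qed.

(** The cases depend on which of [a], [b], [c] divide [m]. *)
Lemma potP (a b c : G) (m : mon) : adj b a -> adj b c -> a != c -> standard m ->
  shift c (pot [set a; b]) m - shift a (pot [set b; c]) m = lam b a c m.
Proof.
move=> ba bc ac std_m; have ab : adj a b by rewrite adj_sym.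
have cb : adj c b by rewrite adj_sym.
have addK x : (0 < mult m x)%N -> (m - mvar x + mvar x)%MM = m.
  move=> mx; apply: multP => y; rewrite !mult_simp.
  by case: eqP => [<-|_]; rewrite ?subnK // subn0 addn0.
(* If [b] divides the standard monomial [m], then [a] and [c] do not, and both sides vanish. *)
have [mb|mb] := posnP (mult m b); last first.
  have m0 x : adj b x -> mult m x = 0%N.
    move=> bx; case: (posnP (mult m x)) => // mx.
    by case: (standardP _ std_m _ _ bx mb mx).
  rewrite !shift0 ?m0 // subr0 lam_mul //.
  apply: standard_sub std_m => x; rewrite !mult_simp.
  by case: eqP => [<-|]; rewrite ?addn0.
have [ma|ma] := posnP (mult m a); have [mc|mc] := posnP (mult m c).
- rewrite !shift0 // subr0.
  case: (boolP (standard (m + mvar b)%MM)) => [std|]; first by rewrite lam_mul.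
  (* Here [lam b a c m] must vanish: [m] involves a third neighbour [d] of [b],
     and multiplying by [d] does not leave the standard monomials. *)
  move=> not_std_b; have [d bd md] : exists2 d, adj b d & (0 < mult m d)%N.
    apply: contrapT => no_d; case/negP: not_std_b.
    have md d : adj b d -> mult m d = 0%N.
      by move=> bd; have [//|md] := posnP (mult m d); case: no_d; exists d.
    apply/standardP => s t st; rewrite !mult_simp.
    case: (b =P s) st => [<- bt|_ st]; last case: (b =P t) st => [<- sb|_ st].
    - by rewrite (md _ bt) => _; case: eqP bt => // ->; rewrite adj_irrefl.
    - by rewrite (md s) // adj_sym.
    - by rewrite !addn0; apply: (standardP _ std_m).
  have md0 x : mult m x = 0%N -> mult (m + mvar d)%MM x = 0%N.
    by move=> mx; rewrite !mult_simp mx; case: eqP mx md => // <- ->.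
  have std_d : standard (m + mvar d)%MM.
    apply: standard_sub std_m => x; rewrite !mult_simp.
    by case: eqP => [<-|]; rewrite ?addn0.
  have := lam_star ba bc bd std_d.
  by rewrite (shiftD _ erefl) !shift0 ?md0 // !addr0 => ->.
(* Only [c] divides [m]: then m / c may still involve [c] but neither [a] nor [b], and [c] itself is
   an admissible auxiliary neighbour. The next case is symmetric. *)
- rewrite (shift0 _ ma) subr0 (@shiftD c _ _ (m - mvar c)%MM) ?addK //.
  rewrite (@pot_neither _ _ c) ?addK //; first by rewrite eq_sym.
  - by rewrite !mult_simp ma.
  - by rewrite !mult_simp mb.
- rewrite (shift0 _ mc) sub0r (@shiftD a _ _ (m - mvar a)%MM) ?addK //.
  rewrite setUC (@pot_neither _ _ a) ?addK //; first by rewrite -lam_anti.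
  - by rewrite !mult_simp mc.
  - by rewrite !mult_simp mb.
(* Both [a] and [c] divide [m]: the two potentials use the same [z], chosen from m / (a c), and
   [lam_star] at m z relates them. *)
have mac : (m - mvar c - mvar a = m - mvar a - mvar c)%MM.
  by rewrite !submDA addmC.
have std_subc : standard (m - mvar c)%MM by apply: standardB.
have subcK : (m - mvar c - mvar a + mvar a = m - mvar c)%MM.
  apply: multP => x; rewrite !mult_simp; case: (a =P x) => [<-|_].
    by rewrite eq_sym (negPf ac) subn0 subnK.
  by rewrite subn0 addn0.
have subaK : (m - mvar a - mvar c + mvar c = m - mvar a)%MM.
  apply: multP => x; rewrite !mult_simp; case: (c =P x) => [<-|_].
    by rewrite (negPf ac) subn0 subnK.
  by rewrite subn0 addn0.
rewrite (@shiftD c _ _ (m - mvar c)%MM) ?addK //.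
rewrite (@shiftD a _ _ (m - mvar a)%MM) ?addK //.
(* A choice exists, since [a] qualifies: m / c is standard. *)
case zP: (base_nbr b (m - mvar c - mvar a)%MM) => [z|]; last first.
  move: zP; rewrite /base_nbr; case: pickP => // /(_ a).
  by rewrite ba subcK std_subc.
have -> : pot [set a; b] (m - mvar c)%MM = lam b a z (m - mvar c + mvar z)%MM.
  apply: pot_one zP; first by rewrite !mult_simp eq_sym (negPf ac) subn0.
  by rewrite !mult_simp mb.
rewrite mac in zP.
have -> : pot [set b; c] (m - mvar a)%MM = lam b c z (m - mvar a + mvar z)%MM.
  rewrite setUC; apply: pot_one zP.
    by rewrite !mult_simp (negPf ac) subn0.
  by rewrite !mult_simp mb.
move: zP; rewrite /base_nbr; case: pickP => // z' /andP[bz std_z] [?]; subst z'.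
(* Restore [c] and [a] to m z / (a c) with [standardD]; no two of [a], [c], [z] are adjacent, all
   being neighbours of [b]. *)
have std : standard (m + mvar z)%MM.
  have -> : (m + mvar z = m - mvar a - mvar c + mvar z + mvar c + mvar a)%MM.
    by rewrite [(_ + mvar z + _)%MM]addmAC subaK addmAC addK.
  apply: standardD; first by apply: no_triangle bc ba.
    apply: standardD std_z _; first by apply: no_triangle bz bc.
    by rewrite subaK; apply: standardB.
  rewrite addmAC -mac subcK.
  have -> : (m - mvar c + mvar z = m - mvar a - mvar c + mvar z + mvar a)%MM.
    by rewrite addmAC -mac subcK.
  apply: standardD std_z _; first by apply: no_triangle bz ba.
  by rewrite -mac subcK.
have := lam_star ba bc bz std.
rewrite (shiftD _ erefl) (@shiftD a _ _ (m - mvar a + mvar z)%MM); last first.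
  by rewrite addmAC addK.
rewrite (@shiftD c _ _ (m - mvar c + mvar z)%MM); last first.
  by rewrite addmAC addK.
rewrite [lam b z a _]lam_anti //; last first.
  apply: standard_sub std => x; rewrite !mult_simp => h.
  by apply: leq_trans h _; rewrite leq_add2r leq_subr.
move=> e; apply/eqP; rewrite eq_sym -subr_eq0 -[X in _ == X]e; apply/eqP.
by rewrite opprB addrA.
Qed.

(** A nonzero value of [pot] at [m] is a value of [lam] at [m] times a variable. This will give
    [pot] finite support. *)
Lemma pot_eq0 (e : {set G}) (m : mon) :
  (forall b a c d, lam b a c (m + mvar d)%MM = 0) -> pot e m = 0.
Proof.
move=> lam0; rewrite /pot; case: pickP => [[x y] _|_].
  by case: base_nbr.
by case: pickP => [[[x y] z] _|].
Qed.

End Potential.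

Lemma scalerZB (S : pzRingType) (M : lmodType S) (r p q : S) (x y : M) :
  r *: (p *: x - q *: y) = (r * p) *: x - (r * q) *: y.
Proof. by rewrite scalerBr !scalerA. Qed.

Lemma sum_delta_pair (S : pzRingType) (M : lmodType S) (I : finType)
    (F : I -> I -> M) (i0 j0 : I) : i0 != j0 ->
  \sum_i \sum_(j | i != j) ((i == i0) && (j == j0))%:R *: F i j = F i0 j0.
Proof.
move=> ne; rewrite (bigD1 i0) //= (bigD1 j0) //= !eqxx scale1r.
rewrite [X in _ + X + _]big1 => [|j /andP[_ /negPf ->]]; last by rewrite scale0r.
rewrite [X in _ + X]big1 => [|i /negPf ->]; first by rewrite !addr0.
by apply: big1 => j _; rewrite scale0r.
Qed.

(** * Values of a homomorphism on relations, for arbitrary generators *)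

Section HomExtension.
Variables (R : comNzRingType) (E : finType) (fam : proper_family R E).
Variable h : HomK fam.
Local Notation Rm := (Rm R E).
Local Notation A := (quot_ring fam).

(* [h] as a function on all of [R^m], with junk value [0] outside [K]. *)
Definition hom_val (w : Rm) : A := h (koszul_class (insubd (0 : ker fam) w)).

Lemma hom_valE (z : ker fam) : hom_val (val z) = h (koszul_class z).
Proof. by rewrite /hom_val valKd. Qed.

Lemma hom_val_lin p w w' : w \in in_ker fam -> w' \in in_ker fam ->
  hom_val (p *: w + w') = to_quot fam p * hom_val w + hom_val w'.
Proof.
move=> kw kw'; pose z := Ker kw; pose z' := Ker kw'.
have valP3 : val (p *: z + z') = p *: w + w' by exact: linearP.
rewrite -valP3 hom_valE koszul_classD koszul_classZ.
rewrite -[w]/(val z) -[w']/(val z') !hom_valE.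
exact: linearP.
Qed.

Lemma hom_val0 : hom_val 0 = 0.
Proof.
have val0 : val (0 : ker fam) = 0 by exact: raddf0.
by rewrite -val0 hom_valE /koszul_class [to_quot_mod _ 0]raddf0 raddf0.
Qed.

Lemma hom_valZ p w : w \in in_ker fam ->
  hom_val (p *: w) = to_quot fam p * hom_val w.
Proof.
move=> kw; have k0 : 0 \in in_ker fam by exact: rpred0.
by have := hom_val_lin p kw k0; rewrite hom_val0 !addr0.
Qed.

Lemma hom_val_koszul e e' : hom_val (koszul fam e e') = 0.
Proof.
pose z := Ker (koszul_in_ker fam e e').
rewrite -[koszul _ _ _]/(val z) hom_valE -hom_val0.
have val0 : val (0 : ker fam) = 0 by exact: raddf0.
rewrite -val0 hom_valE; congr (h _).
apply/koszul_classP; rewrite subr0; apply/asboolP => /=.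
(* The sums in [koszul_sub] omit the diagonal, where the relation is 0. *)
have [<-|ne] := eqVneq e e'.
  exists (fun _ _ => 0); have -> : koszul fam e e = 0 by exact: subrr.
  by rewrite big1 // => ? _; rewrite big1 // => ? _; rewrite scale0r.
exists (fun i j => ((i == e) && (j == e'))%:R).
exact/esym/sum_delta_pair.
Qed.

Lemma gen_in_ideal e : fam e \in gen_ideal fam.
Proof.
apply/asboolP; exists (fun e' => (e' == e)%:R).
rewrite (bigD1 e) //= eqxx mul1r big1 ?addr0 // => e' /negPf ->.
by rewrite mul0r.
Qed.

Lemma gen_quot0 e : to_quot fam (fam e) = 0.
Proof.
by rewrite -(rmorph0 (to_quot fam)); apply/to_quotP; rewrite subr0 gen_in_ideal.
Qed.

Lemma mem_ker_sub p q (x y : Rm) :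
  p * jmap fam x = q * jmap fam y -> p *: x - q *: y \in in_ker fam.
Proof.
have jZ r w : jmap fam (r *: w) = r * jmap fam w by exact: linearZ_LR.
by move=> e; rewrite unfold_in raddfB /= !jZ e subrr.
Qed.

Lemma hom_val_anti p q (x y : Rm) : p * jmap fam x = q * jmap fam y ->
  hom_val (p *: x - q *: y) = - hom_val (q *: y - p *: x).
Proof.
move=> e; have := hom_valZ (-1) (mem_ker_sub (esym e)).
by rewrite scaleN1r opprB rmorphN1 mulN1r.
Qed.

(** The same combination of the three relations is already 0 in R^m: all terms cancel in pairs. *)
Lemma hom_val_star p q r (x y z : Rm) :
    p * jmap fam x = q * jmap fam y -> r * jmap fam y = p * jmap fam z ->
    q * jmap fam z = r * jmap fam x ->
  to_quot fam r * hom_val (p *: x - q *: y)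
  + to_quot fam q * hom_val (r *: y - p *: z)
  + to_quot fam p * hom_val (q *: z - r *: x) = 0.
Proof.
move=> /mem_ker_sub kxy /mem_ker_sub kyz /mem_ker_sub kzx.
rewrite -addrA -(hom_valZ p kzx) -hom_val_lin // ?rpredZ //.
rewrite -hom_val_lin // ?rpredD ?rpredZ //.
rewrite -hom_val0; congr hom_val.
rewrite !scalerBr !scalerA [q * r]mulrC [p * q]mulrC [p * r]mulrC.
by rewrite !addrA !subrK subrr.
Qed.

(** The terms in [y] cancel, and what remains is the Koszul relation of [f] and [e]. *)
Lemma hom_val_path p q r s (y : Rm) (e f : E) :
    fam e = s * q -> fam f = r * p ->
    p * fam e = q * jmap fam y -> r * jmap fam y = s * fam f ->
  to_quot fam r * hom_val (p *: eps R e - q *: y)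
  + to_quot fam q * hom_val (r *: y - s *: eps R f) = 0.
Proof.
rewrite -!(jmap_eps fam) => fe ff /mem_ker_sub kxy /mem_ker_sub kyz.
rewrite -(hom_valZ q kyz) -hom_val_lin // ?rpredZ //.
rewrite -(hom_val_koszul f e) koszulE -!(jmap_eps fam) fe ff; congr hom_val.
by rewrite !scalerBr !scalerA [q * r]mulrC [q * s]mulrC addrA subrK.
Qed.

(** Multiplying by the common factor [b] turns the relation into a Koszul relation. *)
Lemma hom_val_ann p q b (e f : E) : fam e = q * b -> fam f = b * p ->
  to_quot fam b * hom_val (p *: eps R e - q *: eps R f) = 0.
Proof.
move=> fe ff; rewrite -hom_valZ; last first.
  by apply: mem_ker_sub; rewrite !jmap_eps fe ff mulrCA [p * b]mulrC.
rewrite -(hom_val_koszul f e) koszulE fe ff scalerBr !scalerA.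
by rewrite [q * b]mulrC.
Qed.

Section Combination.
Variable g : E -> A.

Definition combine (w : Rm) : A := \sum_e to_quot fam (w e) * g e.

Fact combine_is_linear : linear_for (to_quot fam \; *%R) combine.
Proof.
move=> p w w'; rewrite /combine /= mulr_sumr -big_split /=; apply: eq_bigr => e _.
by rewrite !ffunE rmorphD rmorphM mulrDl mulrA.
Qed.
HB.instance Definition _ :=
  GRing.isLinear.Build R Rm A (to_quot fam \; *%R) combine combine_is_linear.

Lemma combineZ p w : combine (p *: w) = to_quot fam p * combine w.
Proof. exact: linearZ_LR. Qed.

Lemma combineB p q w w' : combine (p *: w - q *: w') =
  to_quot fam p * combine w - to_quot fam q * combine w'.
Proof. by rewrite raddfB /= !combineZ. Qed.

Lemma combine_eps e : combine (eps R e) = g e.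
Proof.
rewrite /combine (bigD1 e) //= ffunE eqxx rmorph1 mul1r big1 ?addr0 //.
by move=> e' /negPf ne; rewrite ffunE ne rmorph0 mul0r.
Qed.

Lemma combine_koszul e f : combine (koszul fam e f) = 0.
Proof.
by rewrite koszulE combineB !gen_quot0 !mul0r subr0.
Qed.

(** Membership in K is included because [hom_val] is linear only there; the property then passes
    from generators of K to all of K. *)
Definition agree (w : Rm) : Prop :=
  w \in in_ker fam /\ hom_val w = combine w.

Lemma agree_lin p w w' : agree w -> agree w' -> agree (p *: w + w').
Proof.
move=> [kw ew] [kw' ew']; split; first by rewrite rpredD ?rpredZ.
by rewrite hom_val_lin // combine_is_linear ew ew'.
Qed.

Lemma agree0 : agree 0.
Proof. by split; [exact: rpred0 | rewrite hom_val0 raddf0]. Qed.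

Lemma agreeZ p w : agree w -> agree (p *: w).
Proof. by move=> aw; have := agree_lin p aw agree0; rewrite addr0. Qed.

Lemma agree_koszul e f : agree (koszul fam e f).
Proof.
by split; [exact: koszul_in_ker | rewrite hom_val_koszul combine_koszul].
Qed.

Lemma mem_im_Phi : (forall w, w \in in_ker fam -> agree w) -> h \in im_Phi (m:=fam).
Proof.
move=> all_agree; apply/asboolP.
exists (combine : {linear Rm -> A | to_quot fam \; *%R}); apply: homP => q.
rewrite -[q]koszul_reprK PhiE -hom_valE.
by have [_ ->] := all_agree _ (ker_valP (koszul_repr q)).
Qed.

End Combination.

End HomExtension.

(** * Syzygies of monomials *)

Section MonomialSyzygies.
Variables (k : fieldType) (n : nat) (E : finType).
Local Notation R := {mpoly k[n]}.
Variables (fam : proper_family R E) (u : E -> 'X_{1..n}).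
Hypothesis famE : forall e, fam e = 'X_[u e].

(** K is generated by binomial syzygies. Lift each monomial of the ideal to R^m by a chosen
    generator; a syzygy differs from the lift of its image, which is 0, by a combination of binomial
    ones. *)
Lemma ker_ind (P : Rm R E -> Prop) :
    P 0 -> (forall p w w', P w -> P w' -> P (p *: w + w')) ->
    (forall e e' m m', (m + u e = m' + u e')%MM ->
      P ('X_[m] *: eps R e - 'X_[m'] *: eps R e')) ->
  forall w, w \in in_ker fam -> P w.
Proof.
move=> P0 Plin Psyz w /eqP jw0.
pose S (mu : 'X_{1..n}) : Rm R E :=
  if [pick e | (u e <= mu)%MM] is Some e then 'X_[mu - u e] *: eps R e else 0.
have PS e m : P ('X_[m] *: eps R e - S (m + u e)%MM).
  rewrite /S; case: pickP => [e' le_e'|/(_ e)]; last by rewrite lem_addl.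
  by apply: Psyz; rewrite submK.
(* [d] exceeds the degrees of all monomials of [w], and [d'] those of their products with
   generators, so [s] loses no term of the image of [w]. *)
pose d := \max_e msize (w e); pose d' := (d + \max_e mdeg (u e))%N.
pose s (p : R) : Rm R E := \sum_(mu : 'X_{1..n < d'}) (p@_mu)%:MP *: S mu.
have s_sum (I : finType) (f : I -> R) : s (\sum_i f i) = \sum_i s (f i).
  rewrite /s exchange_big; apply: eq_bigr => mu _.
  by rewrite /= raddf_sum rmorph_sum scaler_suml.
have sZX c mu : (mdeg mu < d')%N -> s (c *: 'X_[mu]) = c%:MP *: S mu.
  move=> lt_mu; rewrite /s (bigD1 (Sub mu lt_mu)) //= mcoeffZ mcoeffX eqxx mulr1.
  rewrite big1 ?addr0 // => i; rewrite -val_eqE /= => /negPf ne.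
  by rewrite mcoeffZ mcoeffX eq_sym ne mulr0 scale0r.
have wE e : w e = \sum_(m : 'X_{1..n < d}) (w e)@_m *: 'X_[m].
  by apply: mpolywE; rewrite /d (bigD1 e) //= leq_maxl.
have sjw : s (jmap fam w) =
    \sum_e \sum_(m : 'X_{1..n < d}) ((w e)@_m)%:MP *: S (m + u e)%MM.
  rewrite s_sum; apply: eq_bigr => e _; rewrite {1}wE mulr_suml s_sum.
  apply: eq_bigr => m _; rewrite famE -mpoly_scaleAl -mpolyXD sZX //.
  rewrite mdegD -addSn leq_add ?bmdeg //.
  by rewrite (bigD1 e) //= leq_maxl.
(* Subtracting s (jmap fam w) = 0 replaces each term of [w] by one covered by [PS]. *)
have -> : w = \sum_e \sum_(m : 'X_{1..n < d})
    ((w e)@_m)%:MP *: ('X_[m] *: eps R e - S (m + u e)%MM).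
  rewrite -[LHS]subr0 -[X in _ - X](_ : s (jmap fam w) = 0); last first.
    by rewrite jw0 /s big1 // => mu _; rewrite mcoeff0 scale0r.
  rewrite sjw {1}[w]Rm_decomp -sumrB; apply: eq_bigr => e _.
  rewrite {1}wE scaler_suml -sumrB; apply: eq_bigr => m _.
  by rewrite scalerBr scalerA mul_mpolyC.
have Psum (I : finType) (f : I -> Rm R E) : (forall i, P (f i)) -> P (\sum_i f i).
  move=> Pf; elim/big_rec: _ => // i x _ Px.
  by rewrite -[f i]scale1r; apply: Plin.
apply: (Psum) => e; apply: (Psum) => m.
by rewrite -[_ *: _]addr0; apply: Plin.
Qed.

End MonomialSyzygies.

(** * Coefficients in R / I(G) and path relations *)

Section EdgeRing.
Variables (k : fieldType) (G : sgraph).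
Local Notation n := #|G|.
Local Notation R := {mpoly k[n]}.
Local Notation fam := (edge_family k G).
Local Notation A := (quot_ring fam).
Local Notation Rm := (Rm R (edge G)).

Lemma edge_ends (e : edge G) : exists x y : G, adj x y /\ val e = [set x; y].
Proof.
have /imsetP[[x y] /= xy ->] := valP e.
by exists x, y; split.
Qed.

Lemma edge_exists (x y : G) : adj x y -> exists e : edge G, val e = [set x; y].
Proof.
move=> xy; have e_xy : [set x; y] \in edges G.
  by apply/imsetP; exists (x, y).
by exists (Sub [set x; y] e_xy).
Qed.

Definition edge_exp (e : edge G) : 'X_{1..n} := (\sum_(x in val e) mvar x)%MM.

Lemma edge_familyE (e : edge G) : fam e = 'X_[edge_exp e].
Proof. by rewrite /= /edge_mon /var mprodXE. Qed.

Lemma edge_expE (e : edge G) (x y : G) : adj x y -> val e = [set x; y] ->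
  edge_exp e = (mvar x + mvar y)%MM.
Proof.
move=> xy exy; rewrite /edge_exp exy big_setU1 /= ?big_set1 //.
by rewrite inE adj_neq.
Qed.

Lemma mcoeffMX_eq0 (p : R) (m m' : 'X_{1..n}) :
  ~~ (m' <= m)%MM -> (p * 'X_[m'])@_m = 0.
Proof.
move=> nle; apply: memN_msupp_eq0; rewrite (perm_mem (msuppMX p m')).
by apply: contra nle => /mapP[m0 _ ->]; rewrite lem_addr.
Qed.

(** A multiple of an edge monomial has no standard term; conversely, each nonstandard monomial is
    divisible by an edge monomial. *)
Lemma mem_edge_idealP (p : R) :
  p \in gen_ideal fam <-> (forall m, standard m -> p@_m = 0).
Proof.
split.
  case/asboolP => c -> m /standardP std_m.
  rewrite raddf_sum big1 // => e _; rewrite edge_familyE.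
  apply: mcoeffMX_eq0; apply/negP => /mnm_lepP le_em.
  have [x [y [xy exy]]] := edge_ends e.
  move: le_em; rewrite (edge_expE xy exy) => le_em.
  apply: (std_m x y xy).
    by apply: leq_trans (le_em _); rewrite mnm_mult !mult_simp eqxx.
  by apply: leq_trans (le_em _); rewrite mnm_mult !mult_simp eqxx addn1.
move=> p0; rewrite [p]mpolyE; apply: rpred_sum => m _.
have [/p0 ->|/forallPn[x /forallPn[y]]] := boolP (standard m).
  by rewrite scale0r rpred0.
rewrite negb_imply negb_or -!lt0n => /andP[xy /andP[mx my]].
have [e exy] := edge_exists xy.
have -> : m = (m - edge_exp e + edge_exp e)%MM.
  rewrite submK //; apply/mnm_lepP => i.
  rewrite -[i]enum_valK !mnm_mult (edge_expE xy exy) !mult_simp.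
  case: (x =P _) => [<-|_]; last by case: eqP => [<-|].
  by rewrite eq_sym (negPf (adj_neq xy)).
by rewrite mpolyXD mpoly_scaleAl -edge_familyE idealMr ?gen_in_ideal.
Qed.

(** Independent of the representative only for standard [m]. *)
Definition coef (a : A) (m : 'X_{1..n}) : k := (repr a)@_m.

Lemma coef_quot (p : R) m : standard m -> coef (to_quot fam p) m = p@_m.
Proof.
move=> std_m; apply/eqP; rewrite -subr_eq0 -mcoeffB; apply/eqP.
have /mem_edge_idealP : repr (to_quot fam p) - p \in gen_ideal fam.
  by apply/to_quotP; rewrite repr_quotK.
exact.
Qed.

Lemma coef_inj (a b : A) : (forall m, standard m -> coef a m = coef b m) -> a = b.
Proof.
move=> eq_ab; rewrite -[a]repr_quotK -[b]repr_quotK; apply/to_quotP.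
apply/mem_edge_idealP => m /eq_ab.
by rewrite mcoeffB => e; apply/eqP; rewrite subr_eq0; apply/eqP.
Qed.

Lemma coefD (a b : A) m : standard m -> coef (a + b) m = coef a m + coef b m.
Proof.
move=> std_m; rewrite -[a]repr_quotK -[b]repr_quotK -rmorphD.
by rewrite !coef_quot // mcoeffD.
Qed.

Lemma coef0 m : standard m -> coef 0 m = 0.
Proof. by move=> std_m; rewrite -(rmorph0 (to_quot fam)) coef_quot // mcoeff0. Qed.

Lemma coefXM (x : G) (a : A) m : standard m ->
  coef (to_quot fam (var k x) * a) m = shift x (coef a) m.
Proof.
move=> std_m; rewrite -{1}[a]repr_quotK -rmorphM coef_quot // mulrC.
rewrite /shift; case: eqP => mx.
  apply: mcoeffMX_eq0; apply/negP => /mnm_lepP/(_ (enum_rank x)).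
  by rewrite !mnm_mult mult_mvar eqxx mx.
have le_xm : (mvar x <= m)%MM by rewrite lep1mP; apply/eqP.
by rewrite -[in LHS](submK le_xm) addmC; apply: mcoeffMX.
Qed.

Lemma mult_edge_exp (e : edge G) x : mult (edge_exp e) x = (x \in val e).
Proof.
have [a [b [ab eab]]] := edge_ends e.
rewrite (edge_expE ab eab) eab !mult_simp !inE ![x == _]eq_sym.
by case: (a =P x) (adj_neq ab) => [->|_]; rewrite 1?eq_sym => // /negPf ->.
Qed.

Lemma edge_other (e : edge G) b : b \in val e ->
  exists2 a : G, adj b a & val e = [set a; b].
Proof.
have [x [y [xy exy]]] := edge_ends e.
rewrite exy => /set2P[] ->; last by exists x; rewrite // adj_sym.
by exists y; rewrite // setUC.
Qed.

(** The sum has one term if [x] and [y] are adjacent and none otherwise, so that no proof of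
    adjacency is carried along. *)
Definition edge_vec (x y : G) : Rm := \sum_(e : edge G | val e == [set x; y]) eps R e.

Lemma edge_vecC x y : edge_vec x y = edge_vec y x.
Proof. by rewrite /edge_vec setUC. Qed.

Lemma edge_vecE (e : edge G) x y : val e = [set x; y] -> edge_vec x y = eps R e.
Proof.
move=> exy; rewrite /edge_vec -exy.
by rewrite (eq_bigl (pred1 e)) ?big_pred1_eq.
Qed.

Lemma fam_edge (e : edge G) x y : adj x y -> val e = [set x; y] ->
  fam e = var k x * var k y.
Proof. by move=> xy exy; rewrite edge_familyE (edge_expE xy exy) mpolyXD. Qed.

Lemma jmap_edge_vec x y : adj x y -> jmap fam (edge_vec x y) = var k x * var k y.
Proof.
move=> xy; have [e exy] := edge_exists xy.
by rewrite (edge_vecE exy) jmap_eps (fam_edge xy exy).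
Qed.

(* The middle vertex of the path comes first. *)
Definition path_rel (b a c : G) : Rm :=
  var k c *: edge_vec a b - var k a *: edge_vec b c.

Lemma path_rel_jmap b a c : adj b a -> adj b c ->
  var k c * jmap fam (edge_vec a b) = var k a * jmap fam (edge_vec b c).
Proof.
move=> ba bc; rewrite edge_vecC !jmap_edge_vec //.
by rewrite mulrCA [RHS]mulrCA [var k c * _]mulrC.
Qed.

(** * Lifting a given homomorphism to R^m *)

Section Extension.
Hypothesis noC3 : ~ has_induced_cycle G 3.
Hypothesis noC4 : ~ has_induced_cycle G 4.
Variable h : HomK fam.

(** The instance of [lam] to which [potP] is applied. *)
Definition rel_coef b a c : 'X_{1..n} -> k := coef (hom_val h (path_rel b a c)).

Lemma coefN (a : A) m : standard m -> coef (- a) m = - coef a m.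
Proof.
move=> std_m; rewrite -[a]repr_quotK -rmorphN !coef_quot //.
exact: mcoeffN.
Qed.

Lemma rel_coef_anti b a c m : adj b a -> adj b c -> standard m ->
  rel_coef b a c m = - rel_coef b c a m.
Proof.
move=> ba bc std_m; rewrite /rel_coef -coefN //; congr (coef _ m).
rewrite /path_rel [edge_vec c b]edge_vecC [edge_vec b a]edge_vecC.
exact/hom_val_anti/path_rel_jmap.
Qed.

(** [b] annihilates the value of [h], and the coefficient at m b of the product is the one at [m] of
    the value. *)
Lemma rel_coef_mul b a c m : adj b a -> adj b c ->
  standard (m + mvar b)%MM -> rel_coef b a c m = 0.
Proof.
move=> ba bc std_mb; have ab : adj a b by rewrite adj_sym.
have [e eab] := edge_exists ab; have [f fbc] := edge_exists bc.
have ann : to_quot fam (var k b) * hom_val h (path_rel b a c) = 0.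
  rewrite /path_rel (edge_vecE eab) (edge_vecE fbc).
  by apply: hom_val_ann; apply: fam_edge.
have := coefXM b (hom_val h (path_rel b a c)) std_mb.
by rewrite ann coef0 // (shiftD _ (erefl _)).
Qed.

Lemma rel_coef_star b a c d m : adj b a -> adj b c -> adj b d ->
    standard m ->
  shift d (rel_coef b a c) m + shift a (rel_coef b c d) m
    + shift c (rel_coef b d a) m = 0.
Proof.
move=> ba bc bd std_m.
rewrite /rel_coef -!coefXM // -!coefD // -[RHS](coef0 std_m); congr (coef _ m).
rewrite /path_rel [edge_vec b c]edge_vecC [edge_vec b d]edge_vecC [edge_vec b a]edge_vecC.
by apply: hom_val_star; rewrite [in RHS]edge_vecC; apply: path_rel_jmap.
Qed.

Lemma rel_coef_path a b c d m : adj a b -> adj b c -> adj c d ->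
    standard m ->
  shift d (rel_coef b a c) m + shift a (rel_coef c b d) m = 0.
Proof.
move=> ab bc cd std_m.
have [e eab] := edge_exists ab; have [f fcd] := edge_exists cd.
have ba : adj b a by rewrite adj_sym.
have cb : adj c b by rewrite adj_sym.
rewrite /rel_coef -!coefXM // -!coefD // -[RHS](coef0 std_m); congr (coef _ m).
rewrite /path_rel (edge_vecE eab) (edge_vecE fcd).
apply: hom_val_path.
- by rewrite (fam_edge ab eab) mulrC.
- by rewrite (fam_edge cd fcd) mulrC.
- by rewrite -jmap_eps -(edge_vecE eab) path_rel_jmap.
- by rewrite -jmap_eps -(edge_vecE fcd) path_rel_jmap.
Qed.

(** A degree bound uniform in all triples, beyond which [pot] vanishes; it makes [pot_poly] a
    polynomial. *)
Definition rel_bound : nat :=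
  \max_(t : G * G * G) msize (repr (hom_val h (path_rel t.1.1 t.1.2 t.2))).

Lemma rel_coef_bound b a c m : (rel_bound <= mdeg m)%N -> rel_coef b a c m = 0.
Proof.
move=> le_m; apply: memN_msupp_eq0; apply: msize_mdeg_ge; apply: leq_trans le_m.
by rewrite /rel_bound (bigD1 (b, a, c)) //= leq_maxl.
Qed.

Definition pot_poly (e : edge G) : R :=
  \sum_(m : 'X_{1..n < rel_bound}) pot rel_coef (val e) m *: 'X_[m].

Lemma mcoeff_pot_poly e m : (pot_poly e)@_m = pot rel_coef (val e) m.
Proof.
have [lt_m|le_m] := ltnP (mdeg m) rel_bound; first exact: mcoeff_mpoly.
rewrite pot_eq0 => [|b a c d]; last first.
  by apply: rel_coef_bound; rewrite mdegD (leq_trans le_m) ?leq_addr.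
rewrite /pot_poly raddf_sum big1 // => m' _.
rewrite /= mcoeffZ mcoeffX; case: eqP => [em|_]; last by rewrite mulr0.
by have := bmdeg m'; rewrite em ltnNge le_m.
Qed.

Local Notation pot_quot := (fun e => to_quot fam (pot_poly e)).

Lemma agree_path_rel b a c : adj b a -> adj b c -> a != c ->
  agree h pot_quot (path_rel b a c).
Proof.
move=> ba bc ac; have ab : adj a b by rewrite adj_sym.
have [e eab] := edge_exists ab; have [f fbc] := edge_exists bc.
split; first exact: mem_ker_sub (path_rel_jmap ba bc).
apply: coef_inj => m std_m.
rewrite -[LHS]/(rel_coef b a c m).
rewrite -(potP noC3 noC4 rel_coef_anti rel_coef_mul rel_coef_star rel_coef_path) //.
rewrite /path_rel (edge_vecE eab) (edge_vecE fbc) combineB !combine_eps.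
rewrite coefD // coefN // !coefXM // -eab -fbc.
(* A quotient of [m] by a variable is again standard, so [coef] reads off the coefficients of
   [pot_poly] there. *)
by congr (_ - _); rewrite /shift; case: ifP => // _;
  rewrite coef_quot ?mcoeff_pot_poly // standardB.
Qed.

(** Distinct edges share at most one vertex. If they share one, the syzygy is a monomial multiple of
    a path relation; if they are disjoint, of a Koszul relation. *)
Lemma agree_syzygy (e f : edge G) m m' :
    (m + edge_exp e = m' + edge_exp f)%MM ->
  agree h pot_quot ('X_[m] *: eps R e - 'X_[m'] *: eps R f).
Proof.
have [<-|ne] := eqVneq e f => eq_m.
  by rewrite (addIm eq_m) subrr; apply: agree0.
have mult_eq x : (mult m x + (x \in val e) = mult m' x + (x \in val f))%N.
  by rewrite -!mult_edge_exp -!multD eq_m.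
have [b /andP[/edge_other[a ba eab] /edge_other[c bc fcb]]|disj] :=
  pickP [pred b | (b \in val e) && (b \in val f)].
- have ac : a != c.
    by apply: contraNneq ne => ac; rewrite -val_eqE eab fcb ac.
  have ab : adj a b by rewrite adj_sym.
  have cb : adj c b by rewrite adj_sym.
  (* [c] lies on [f] but not on [e], so it divides [m]. *)
  have mE : m = (m - mvar c + mvar c)%MM.
    rewrite submK // lep1mP -lt0n -/(mult m c).
    have := mult_eq c; rewrite eab fcb !inE eqxx eq_sym (negPf ac) (negPf (adj_neq cb)).
    by rewrite addn0 addn1 => ->.
  have m'E : m' = (m - mvar c + mvar a)%MM.
    apply: (@addIm _ (edge_exp f)); rewrite -eq_m {1}mE.
    rewrite (edge_expE ab eab) (edge_expE cb fcb) !addmA.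
    by rewrite [(_ + mvar c + mvar a)%MM]addmAC.
  rewrite mE m'E !mpolyXD -scalerZB.
  apply: agreeZ; rewrite -(edge_vecE eab) -(edge_vecE fcb) [edge_vec c b]edge_vecC.
  exact: agree_path_rel.
(* The edge monomials are coprime, so that of [f] divides [m]. *)
have mE : m = (m - edge_exp f + edge_exp f)%MM.
  rewrite submK //; apply/mnm_lepP => i; rewrite -[i]enum_valK !mnm_mult.
  rewrite mult_edge_exp; case: (boolP (_ \in val f)) => // xf.
  have := mult_eq (enum_val i); have := disj (enum_val i).
  by rewrite /= xf andbT => ->; rewrite addn0 addn1 => ->.
have m'E : m' = (m - edge_exp f + edge_exp e)%MM.
  by apply: (@addIm _ (edge_exp f)); rewrite -eq_m {1}mE addmAC.
rewrite mE m'E !mpolyXD -scalerZB -!edge_familyE -koszulE.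
exact/agreeZ/agree_koszul.
Qed.

Lemma hom_mem_im_Phi : h \in im_Phi (m:=fam).
Proof.
apply: mem_im_Phi (ker_ind edge_familyE _ _ _).
- exact: agree0.
- exact: agree_lin.
- exact: agree_syzygy.
Qed.

End Extension.

End EdgeRing.

Theorem corollary4p10 (k : fieldType) (G : sgraph)
  (no_isol : no_isolated G)
  (no_induced_C3 : ~ has_induced_cycle G 3)
  (no_induced_C4 : ~ has_induced_cycle G 4) :
  forall x : T2 (edge_family k G), x = 0.
Proof.
move=> x; rewrite -[x]of_quot_modK -[RHS](of_quot_modK 0).
by apply/to_quot_modP; apply: hom_mem_im_Phi.
Qed.
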